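(* Let $P$ be a binary $k\times n$ matrix with rows $\mathbf{p}\in\mathbb{F}_2^n$ and $\theta\in\mathbb{R}$, let $\mathbf{H}_P=\sum_{\mathbf{p}}\theta\prod_{j:p_j=1}X_j$, and let $\mathbf{X}$ be the random variable on $\mathbb{F}_2^n$ with $\Pr(\mathbf{X}=\mathbf{x})=|\langle\mathbf{x}|\exp(i\mathbf{H}_P)|\mathbf{0}\rangle|^2$. For $\mathbf{s}\in\mathbb{F}_2^n$ let $P_{\mathbf{s}}$ be the submatrix of rows $\mathbf{p}$ with $\mathbf{p}\cdot\mathbf{s}^T=1$, $n_{\mathbf{s}}$ its number of rows, and $\mathcal{C}_{\mathbf{s}}\subseteq\mathbb{F}_2^{n_{\mathbf{s}}}$ the linear code spanned by the columns of $P_{\mathbf{s}}$. Then \[ \Pr(\mathbf{X}\cdot\mathbf{s}^T=0)=\mathbb{E}_{\mathbf{c}\sim\mathcal{C}_{\mathbf{s}}}\Bigl[\cos^2\bigl(\theta(n_{\mathbf{s}}-2\,\mathrm{wt}(\mathbf{c}))\bigr)\Bigr], \] where $\mathbf{c}$ is uniform on $\mathcal{C}_{\mathbf{s}}$; in particular this probability depends only on $\theta$ and the weight enumerator polynomial of $\mathcal{C}_{\mathbf{s}}$ (a matroid invariant of $P_{\mathbf{s}}$).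
   Context: $X_j$ is the Pauli $X$ on qubit $j$ of $n$ qubits; rows of $P$ may repeat. $\mathrm{wt}$ is Hamming weight. The weight enumerator of a length-$\ell$ code $\mathcal{C}$ is $\sum_{\mathbf{c}\in\mathcal{C}}x^{\mathrm{wt}(\mathbf{c})}y^{\ell-\mathrm{wt}(\mathbf{c})}$. The matroid of a binary matrix is its equivalence class under row permutations and column operations (column-echelon reduction with empty columns deleted). *)

(* Defs.v *)
From HB Require Import structures.
From mathcomp Require Import all_boot all_order all_algebra all_fingroup.
From mathcomp Require Import polyXY complex.
From mathcomp Require Import all_classical all_reals all_analysis.

Set Implicit Arguments.
Unset Strict Implicit.
Unset Printing Implicit Defensive.

Import Order.TTheory GRing.Theory Num.Theory.
Import numFieldNormedType.Exports.

Local Open Scope classical_set_scope.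
Local Open Scope ring_scope.

(* Operators on n qubits are square matrices whose rows and columns are the
   computational basis states, i.e. the vectors of F_2^n, numbered by
   enum_rank/enum_val. *)
Definition qubit_dim (n : nat) : nat := #|{: 'rV['F_2]_n}|.

Definition basis_label (n : nat) (a : 'I_(qubit_dim n)) : 'rV['F_2]_n :=
  enum_val a.

Definition bra_ket (C : Type) (n : nat) (x : 'rV['F_2]_n)
    (A : 'M[C]_(qubit_dim n)) (y : 'rV['F_2]_n) : C :=
  A (enum_rank x) (enum_rank y).

(* The indices of 'M_2 are the elements of 'I_2, which is convertible to 'F_2. *)
Definition pauliX (C : pzRingType) : 'M[C]_2 :=
  \matrix_(a < 2, b < 2) (a != b)%:R.

(* The tensor product with pauliX at position j and the 2 x 2 identity at all
   the other positions: its entries are products of entries of the factors. *)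
Definition pauliX_on (C : pzRingType) (n : nat) (j : 'I_n) :
    'M[C]_(qubit_dim n) :=
  \matrix_(a, b) \prod_(l < n)
    (if l == j then pauliX C else 1%:M)
      (basis_label a ord0 l) (basis_label b ord0 l).

(* The limit is that of the topology of matrices, i.e. it is entrywise. *)
Definition expmx (K : numFieldType) (N : nat) (A : 'M[K]_N) : 'M[K]_N :=
  limn (series (fun m : nat => (m`!%:R)^-1 *: A ^+ m)).

Definition hamiltonian (R : realType) (k n : nat) (P : 'M['F_2]_(k, n))
    (theta : R) : 'M[R[i]]_(qubit_dim n) :=
  \sum_(r < k) (theta%:C)%C *: \prod_(j < n | P r j == 1) pauliX_on R[i] j.

(* normc is the R-valued modulus on R[i]. *)
Definition outcome_prob (R : realType) (k n : nat) (P : 'M['F_2]_(k, n))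
    (theta : R) (x : 'rV['F_2]_n) : R :=
  ComplexField.Normc.normc
    (bra_ket x (expmx ('i%C *: hamiltonian P theta)) 0) ^+ 2.

(* F_2^n carries the discrete sigma-algebra. *)
Definition has_outcome_law (R : realType) (k n : nat) (P : 'M['F_2]_(k, n))
    (theta : R) (d : measure_display) (T : measurableType d)
    (Pr : probability T R) (X : T -> 'rV['F_2]_n) : Prop :=
  (forall A : set 'rV['F_2]_n, measurable (X @^-1` A)) /\
  (forall x : 'rV['F_2]_n,
     Pr (X @^-1` [set x]) = (outcome_prob P theta x)%:E).

Definition dotv (n : nat) (x s : 'rV['F_2]_n) : 'F_2 :=
  (x *m s^T) ord0 ord0.

Definition kept_rows (k n : nat) (P : 'M['F_2]_(k, n)) (s : 'rV['F_2]_n) :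
    {set 'I_k} :=
  [set r | dotv (row r P) s == 1]%SET.

Definition row_count (k n : nat) (P : 'M['F_2]_(k, n)) (s : 'rV['F_2]_n) : nat :=
  #|kept_rows P s|.

Definition row_part (k n : nat) (P : 'M['F_2]_(k, n)) (s : 'rV['F_2]_n) :
    'M['F_2]_(row_count P s, n) :=
  rowsub (fun i : 'I_(row_count P s) => enum_val i) P.

Definition column_code (l n : nat) (A : 'M['F_2]_(l, n)) :
    {vspace 'cV['F_2]_l} :=
  <<[seq col j A | j <- enum 'I_n]>>%VS.

Definition wt (l : nat) (c : 'cV['F_2]_l) : nat :=
  #|[set i | c i ord0 != 0]%SET|.

Definition weight_enumerator (l : nat) (C : {vspace 'cV['F_2]_l}) :
    {poly {poly int}} :=
  \sum_(c : 'cV['F_2]_l | c \in C) 'X ^+ wt c * 'Y ^+ (l - wt c).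

Definition uniform_expectation (R : realType) (l : nat)
    (C : {vspace 'cV['F_2]_l}) (f : 'cV['F_2]_l -> R) : R :=
  (\sum_(c : 'cV['F_2]_l | c \in C) f c) / #|C|%:R.

(* The matroid of a binary matrix is its class for this relation.  Scaling a
   column by a unit is trivial over F_2, and since columns can be swapped the
   position of the empty column does not matter. *)
Inductive same_matroid : forall l n l' n' : nat,
    'M['F_2]_(l, n) -> 'M['F_2]_(l', n') -> Prop :=
| sm_refl l n (A : 'M['F_2]_(l, n)) : same_matroid A A
| sm_sym l n l' n' (A : 'M['F_2]_(l, n)) (B : 'M['F_2]_(l', n')) :
    same_matroid A B -> same_matroid B A
| sm_trans l n l' n' l'' n'' (A : 'M['F_2]_(l, n)) (B : 'M['F_2]_(l', n'))
    (C : 'M['F_2]_(l'', n'')) :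
    same_matroid A B -> same_matroid B C -> same_matroid A C
| sm_row_perm l n (u : 'S_l) (A : 'M['F_2]_(l, n)) :
    same_matroid A (row_perm u A)
| sm_col_swap l n (j1 j2 : 'I_n) (A : 'M['F_2]_(l, n)) :
    same_matroid A (xcol j1 j2 A)
| sm_col_add l n (j1 j2 : 'I_n) (A : 'M['F_2]_(l, n)) :
    j1 != j2 ->
    same_matroid A (\matrix_(r, j) (A r j + (if j == j2 then A r j1 else 0)))
| sm_empty_col l n (A : 'M['F_2]_(l, n)) :
    same_matroid A (row_mx A (0 : 'M['F_2]_(l, 1))).

(* Main.v *)
Require Import Defs.
From HB Require Import structures.
From mathcomp Require Import all_boot all_order all_algebra all_fingroup.
From mathcomp Require Import polyXY complex.
From mathcomp Require Import all_classical all_reals all_analysis.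
From mathcomp Require Import ring.

(* The characters (-1)^(x.a) of F_2^n are eigenvectors of every product of Pauli
   X's, hence of H_P, with eigenvalues
     E(a) = theta * sum over the rows p of (-1)^(p.a).
   So <x|exp(i H_P)|0> is the Fourier transform of e^(i E(a)), and
   autocorrelation turns the mean of (-1)^(X.s) into the mean over a of
   cos (E(a) - E(a+s)).  Only the rows with p.s = 1 survive in E(a) - E(a+s),
   which is 2 theta (n_s - 2 wt(P_s a)); the half-angle formula gives cos^2, and
   a -> P_s a pushes the uniform law of F_2^n to the uniform law of the code.
   The expectation is read off the coefficients of the enumerator: the monomial
   X^i Y^j contributes the value at n_s - 2 wt(c) = j - i. *)

Set Implicit Arguments.
Unset Strict Implicit.
Unset Printing Implicit Defensive.

Import Order.TTheory GRing.Theory Num.Theory.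
Import numFieldNormedType.Exports.

Local Open Scope classical_set_scope.
Local Open Scope ring_scope.

(** * Exponentials of diagonalizable matrices *)

Lemma cvg_mx (T : topologicalType) (m n : nat) (u : nat -> 'M[T]_(m, n))
    (M : 'M[T]_(m, n)) :
  (forall i j, (fun k => u k i j) @ \oo --> M i j) -> u @ \oo --> M.
Proof.
move=> h A [P PM PA].
suff : \forall k \near \oo, forall i j, P i j (u k i j).
  by apply: filterS => k /= hk; apply: PA.
by apply: filter_forall => i; apply: filter_forall => j; apply: h; apply: PM.
Qed.

Lemma expr_diag_mx (K : comPzRingType) (N m : nat) (d : 'rV[K]_N) :
  diag_mx d ^+ m = diag_mx (\row_a d 0 a ^+ m).
Proof.
elim: m => [|m IH].
  rewrite expr0; apply/matrixP => i j; rewrite !mxE; case: eqP => [->|//].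
  by rewrite expr0.
by rewrite exprS IH [LHS]mulmx_diag; apply/matrixP => i j; rewrite !mxE exprS.
Qed.

(** Powers telescope to [V *m diag_mx d ^+ m *m W], so each entry of a partial sum is a fixed finite
    combination of scalar partial sums. The scalar limits [e] are a hypothesis, so that they can be
    given later in terms of [cos] and [sin]. *)
Lemma expmx_diagonalizable (K : numFieldType) (N : nat) (V W A : 'M[K]_N)
    (d e : 'rV[K]_N) :
  W *m V = 1%:M -> A = V *m diag_mx d *m W -> V *m W = 1%:M ->
  (forall a, series (fun m : nat => (m`!%:R)^-1 * d 0 a ^+ m) @ \oo --> e 0 a) ->
  expmx A = V *m diag_mx e *m W.
Proof.
move=> WV AE VW he.
have AX m : A ^+ m = V *m diag_mx (\row_a d 0 a ^+ m) *m W.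
  rewrite -expr_diag_mx; elim: m => [|m IH]; first by rewrite !expr0 mulmx1 VW.
  rewrite exprS IH {1}AE exprS.
  transitivity (V *m diag_mx d *m (W *m V) *m diag_mx d ^+ m *m W).
    have mulE (B C : 'M[K]_N) : B * C = B *m C by [].
    by rewrite mulE !mulmxA.
  by rewrite WV mulmx1 -(mulmxA V).
apply: cvg_lim => //; apply: cvg_mx => i j.
have -> : (V *m diag_mx e *m W) i j = \sum_a V i a * e 0 a * W a j.
  by rewrite mxE; apply: eq_bigr => a _; rewrite mul_mx_diag mxE.
have -> : (fun k => series (fun m => (m`!%:R)^-1 *: A ^+ m) k i j) =
    fun k => \sum_a
      V i a * series (fun m : nat => (m`!%:R)^-1 * d 0 a ^+ m) k * W a j.
  apply/funext => k; rewrite /series /= summxE.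
  under [RHS]eq_bigr => a _ do rewrite mulr_sumr mulr_suml.
  rewrite exchange_big /=; apply: eq_bigr => m _.
  rewrite mxE AX mxE mulr_sumr; apply: eq_bigr => a _.
  by rewrite mul_mx_diag !mxE; ring.
apply: (@cvg_big _ _ +%R) => [|a _]; first exact: add_continuous.
by apply: cvgMr_tmp; apply: cvgMl_tmp; apply: he.
Qed.

(** * Signs and the dot product over the two-element field *)

Lemma F2_eq0 (t : 'F_2) : (t != 0) = (t == 1).
Proof. by case: t => [[|[|]]]. Qed.

Lemma F2_addr_eq0 (V : lmodType 'F_2) (u v : V) : (u + v == 0) = (u == v).
Proof.
suff vN : - v = v by rewrite -[v in LHS]opprK subr_eq0 vN.
by rewrite -scaleN1r (_ : -1 = 1 :> 'F_2) ?scale1r //; apply/eqP.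
Qed.

(** The nontrivial additive character of ['F_2]; the target ring varies because it is used both in
    [R] and in [R[i]]. *)
Definition F2_sign {K : pzRingType} (t : 'F_2) : K := (-1) ^+ (t != 0).

Lemma F2_signD (K : pzRingType) (t u : 'F_2) :
  F2_sign (t + u) = F2_sign t * F2_sign u :> K.
Proof.
rewrite /F2_sign -signr_addb; congr ((-1) ^+ nat_of_bool _).
by case: t u => [[|[|]]] // ? [[|[|]]].
Qed.

Lemma F2_sign0 (K : pzRingType) : F2_sign 0 = 1 :> K.
Proof. by []. Qed.

Lemma F2_sign_sum (K : pzRingType) (I : Type) (r : seq I) (P : pred I)
    (t : I -> 'F_2) :
  F2_sign (\sum_(i <- r | P i) t i) = \prod_(i <- r | P i) F2_sign (t i) :> K.
Proof. exact: (big_morph _ (@F2_signD K) (F2_sign0 K)). Qed.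

Lemma rmorph_F2_sign (K L : pzRingType) (f : {rmorphism K -> L}) (t : 'F_2) :
  f (F2_sign t) = F2_sign t.
Proof. exact: rmorph_sign. Qed.

Lemma dotvE (n : nat) (x s : 'rV['F_2]_n) : dotv x s = \sum_j x 0 j * s 0 j.
Proof. by rewrite /dotv mxE; apply: eq_bigr => j _; rewrite mxE. Qed.

Lemma dotvC (n : nat) (x s : 'rV['F_2]_n) : dotv x s = dotv s x.
Proof. by rewrite !dotvE; apply: eq_bigr => j _; rewrite mulrC. Qed.

Lemma dotv0 (n : nat) (x : 'rV['F_2]_n) : dotv x 0 = 0.
Proof. by rewrite /dotv trmx0 mulmx0 mxE. Qed.

Lemma dotvDl (n : nat) (x y s : 'rV['F_2]_n) :
  dotv (x + y) s = dotv x s + dotv y s.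
Proof. by rewrite /dotv mulmxDl mxE. Qed.

Lemma dotvDr (n : nat) (x y s : 'rV['F_2]_n) :
  dotv s (x + y) = dotv s x + dotv s y.
Proof. by rewrite !(dotvC s) dotvDl. Qed.

Lemma dotv_delta (n : nat) (x : 'rV['F_2]_n) (j : 'I_n) :
  dotv x (delta_mx 0 j) = x 0 j.
Proof.
rewrite dotvE (bigD1 j) //= big1 ?addr0 => [|l lj].
  by rewrite mxE !eqxx mulr1.
by rewrite mxE (negbTE lj) andbF mulr0.
Qed.

Lemma dotv_row (k n : nat) (P : 'M['F_2]_(k, n)) (r : 'I_k) (a : 'rV_n) :
  dotv (row r P) a = (P *m a^T) r 0.
Proof. by rewrite /dotv !mxE; apply: eq_bigr => j _; rewrite !mxE. Qed.

(** * Fourier analysis on the vectors over ['F_2] *)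

Lemma qubit_dim_neq0 (K : numDomainType) (n : nat) : (qubit_dim n)%:R != 0 :> K.
Proof. by rewrite pnatr_eq0 -lt0n; apply/card_gt0P; exists 0. Qed.

(* Translating by a unit vector not orthogonal to d flips the sign of the sum. *)
Lemma sum_F2_sign_dotv (K : numFieldType) (n : nat) (d : 'rV['F_2]_n) :
  \sum_x F2_sign (dotv x d) = (qubit_dim n)%:R * (d == 0)%:R :> K.
Proof.
have [->|] := eqVneq d 0.
  under eq_bigr => x _ do rewrite dotv0 F2_sign0.
  by rewrite sumr_const mulr1.
case/rV0Pn=> j dj; rewrite mulr0.
set S := LHS; suff : S = - S.
  by move/eqP; rewrite -addr_eq0 -mulr2n mulrn_eq0 => /eqP.
rewrite {1}/S (reindex_inj (addrI (delta_mx 0 j))) /= -sumrN.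
apply: eq_bigr => x _; rewrite dotvDl F2_signD dotvC dotv_delta.
by rewrite {1}/F2_sign dj expr1 mulN1r.
Qed.

Lemma sum_F2_sign_mul (K : numFieldType) (n : nat) (a b : 'rV['F_2]_n) :
  \sum_x F2_sign (dotv x a) * F2_sign (dotv x b) =
  (qubit_dim n)%:R * (a == b)%:R :> K.
Proof.
under eq_bigr => x _ do rewrite -F2_signD -dotvDr.
by rewrite sum_F2_sign_dotv F2_addr_eq0.
Qed.

(** Expanding the square and summing over [x] first, orthogonality of characters leaves only
    [b = a + s]. The square has no conjugation; the lemma serves the real and imaginary parts of the
    amplitude separately. *)
Lemma fourier_correlation (K : numFieldType) (n : nat) (f : 'rV['F_2]_n -> K)
    (s : 'rV['F_2]_n) :
  \sum_x F2_sign (dotv x s) * (\sum_a F2_sign (dotv x a) * f a) ^+ 2 =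
  (qubit_dim n)%:R * \sum_a f a * f (a + s).
Proof.
transitivity (\sum_a \sum_b f a * f b *
   \sum_x F2_sign (dotv x (a + s)) * F2_sign (dotv x b)).
  under [RHS]eq_bigr => a _.
    under eq_bigr => b _ do rewrite mulr_sumr.
    rewrite exchange_big /=; over.
  rewrite exchange_big /=; apply: eq_bigr => x _.
  rewrite expr2 mulr_suml mulr_sumr; apply: eq_bigr => a _.
  rewrite mulr_sumr mulr_sumr; apply: eq_bigr => b _.
  by rewrite dotvDr F2_signD; ring.
rewrite mulr_sumr; apply: eq_bigr => a _.
rewrite (bigD1 (a + s)) //= [X in _ + X]big1 ?addr0 => [|b bas].
  by rewrite sum_F2_sign_mul eqxx mulr1 mulrC.
by rewrite sum_F2_sign_mul eq_sym (negbTE bas) !mulr0.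
Qed.

(** * The exponential series at an imaginary argument *)

Lemma cvg_real_complex (R : realType) (u : nat -> R) (l : R) :
  u @ \oo --> l ->
  (fun m => (u m)%:C%C : (R[i] : numFieldType)) @ \oo -->
  (l%:C%C : (R[i] : numFieldType)).
Proof.
move=> ul; apply/cvgrPdist_lt => -[e e'] /=.
(* Radii in [R[i]] are complex numbers; a positive one has zero imaginary part, so [e] serves as the
   real radius. *)
rewrite ltcE /= => /andP[/eqP -> e0].
have /cvgrPdist_lt/(_ e e0) := ul; apply: filterS => m um.
by rewrite -rmorphB normc_def /= expr0n addr0 sqrtr_sqr ltcR.
Qed.

(** The parity factors are those of [cos_coeff] and [sin_coeff], so the two series match term by
    term. At [m = 0] the truncated [m.-1] is harmless, since [odd m] kills that term. *)
Lemma expr_iC (R : realType) (t : R) (m : nat) :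
  ('i * t%:C)%C ^+ m =
  (((~~ odd m)%:R * (-1) ^+ m./2 * t ^+ m) +i*
   ((odd m)%:R * (-1) ^+ m.-1./2 * t ^+ m))%C.
Proof.
elim: m => [|m IH]; first by rewrite !expr0 /= !mulr1.
rewrite exprS IH; simpc; rewrite -[m]odd_double_half.
case: (odd m); rewrite /= ?add1n ?add0n /= ?odd_double ?doubleK ?uphalf_double /=.
  by rewrite !exprS !(mul0r, mul1r, mulr0, mulN1r) !mulNr [in RHS]mulrCA.
by rewrite !exprS !(mul0r, mul1r, mulr0, oppr0) mulrCA.
Qed.

Lemma cvg_expi (R : realType) (t : R) :
  series (fun m : nat => (m`!%:R)^-1 * (('i * t%:C)%C : (R[i] : numFieldType)) ^+ m)
    @ \oo --> ((cos t +i* sin t)%C : (R[i] : numFieldType)).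
Proof.
have -> : series (fun m : nat =>
      (m`!%:R)^-1 * (('i * t%:C)%C : (R[i] : numFieldType)) ^+ m) =
    fun k => ((series (cos_coeff t) k)%:C%C +
      'i%C * (series (sin_coeff t) k)%:C%C : (R[i] : numFieldType)).
  apply/funext => k; rewrite /series /= !rmorph_sum /= mulr_sumr -big_split /=.
  apply: eq_bigr => m _; rewrite expr_iC -[in LHS](rmorph_nat (real_complex R)).
  rewrite -fmorphV /cos_coeff /sin_coeff /=; simpc.
  by congr (_ +i* _)%C; rewrite mulrC.
have -> : (cos t +i* sin t)%C = (cos t)%:C%C + 'i%C * (sin t)%:C%C :> R[i].
  by simpc.
apply: cvgD.
  by apply: cvg_real_complex; rewrite unlock; exact: is_cvg_series_cos_coeff.
apply: cvgMl_tmp; apply: cvg_real_complex; rewrite unlock.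
exact: is_cvg_series_sin_coeff.
Qed.

(** * Diagonalizing the Hamiltonian by characters *)

Lemma big_basis_label (K : Type) (idx : K) (op : Monoid.com_law idx) (n : nat)
    (F : 'rV['F_2]_n -> K) :
  \big[op/idx]_(a < qubit_dim n) F (basis_label a) = \big[op/idx]_x F x.
Proof.
rewrite [RHS](reindex (@basis_label n)) //.
by apply: onW_bij; exact: enum_val_bij.
Qed.

(** All factors have entries 0 or 1, and a single disagreeing coordinate makes the product vanish:
    this is the permutation matrix of a translation. *)
Lemma pauliX_onE (K : comPzRingType) (n : nat) (j : 'I_n)
    (a b : 'I_(qubit_dim n)) :
  pauliX_on K j a b = (basis_label b == basis_label a + delta_mx 0 j)%:R.
Proof.
rewrite mxE; set x := basis_label a; set y := basis_label b.
have E l : (if l == j then pauliX K else 1%:M) (x 0 l) (y 0 l) =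
    (y 0 l == (x + delta_mx 0 j) 0 l)%:R.
  rewrite !mxE eqxx /=; case: (l == j); rewrite mxE; congr (nat_of_bool _)%:R.
    by case: (x 0 l) (y 0 l) => [[|[|]]] // ? [[|[|]]].
  by rewrite addr0 eq_sym.
have [yE|] := eqVneq y (x + _).
  by rewrite big1 // => l _; rewrite E yE eqxx.
rewrite -subr_eq0 => /rV0Pn[l]; rewrite !mxE subr_eq0 => yl.
by rewrite (bigD1 l) //= E !mxE (negbTE yl) mul0r.
Qed.

(** The Walsh-Hadamard matrix, left unnormalized to avoid a square root; its square is [qubit_dim n]
    times the identity. *)
Definition character_mx (K : pzRingType) (n : nat) : 'M[K]_(qubit_dim n) :=
  \matrix_(a, b) F2_sign (dotv (basis_label a) (basis_label b)).

Lemma character_mx_sqr (K : numFieldType) (n : nat) :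
  character_mx K n *m character_mx K n = (qubit_dim n)%:R%:M.
Proof.
apply/matrixP => a b; rewrite mxE.
under eq_bigr => c _ do rewrite !mxE dotvC.
rewrite (big_basis_label _ (fun x => F2_sign (dotv x _) * F2_sign (dotv x _))).
by rewrite sum_F2_sign_mul mxE (inj_eq enum_val_inj) mulr_natr.
Qed.

Lemma pauliX_on_character (K : numFieldType) (n : nat) (j : 'I_n) :
  pauliX_on K j *m character_mx K n =
  character_mx K n *m diag_mx (\row_a F2_sign (basis_label a 0 j)).
Proof.
apply/matrixP => a b; rewrite mul_mx_diag !mxE.
under eq_bigr => c _ do rewrite pauliX_onE mxE.
rewrite (big_basis_label _ (fun y => (y == _)%:R * F2_sign (dotv y _))).
rewrite (bigD1 (basis_label a + delta_mx 0 j)) //= big1 ?addr0 => [|y].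
  by rewrite eqxx mul1r dotvDl F2_signD [dotv (delta_mx _ _) _]dotvC dotv_delta.
by move/negbTE->; rewrite mul0r.
Qed.

Lemma pauliX_prod_character (K : numFieldType) (n : nat) (p : 'rV['F_2]_n) :
  (\prod_(j < n | p 0 j == 1) pauliX_on K j) *m character_mx K n =
  character_mx K n *m diag_mx (\row_a F2_sign (dotv p (basis_label a))).
Proof.
(* Coordinates with [p 0 j = 0] contribute the sign 1, so both sides become products over the same
   qubits. *)
have -> : \row_a F2_sign (dotv p (basis_label a)) =
    \row_a \prod_(j < n | p 0 j == 1) F2_sign (basis_label a 0 j) :> 'rV[K]__.
  apply/rowP => a; rewrite !mxE dotvE F2_sign_sum [RHS]big_mkcond /=.
  apply: eq_bigr => j _; rewrite -F2_eq0.
  by case: eqVneq => [->|]; [rewrite mul0r | rewrite F2_eq0 => /eqP->; rewrite mul1r].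
(* Induction over an arbitrary list of qubits: each Pauli factor passes through the characters and
   adds one sign to the diagonal. *)
elim: (index_enum _) => [|j r IH].
  rewrite big_nil mul1mx; apply/matrixP => a b.
  by rewrite mul_mx_diag !mxE big_nil mulr1.
rewrite big_cons; have [pj|pj] := ifP; last first.
  rewrite IH; apply/matrixP => a b; rewrite !mul_mx_diag !mxE.
  by rewrite big_cons pj.
have mulE (B C : 'M[K]_(qubit_dim n)) : B * C = B *m C by [].
rewrite mulE -mulmxA IH mulmxA pauliX_on_character -mulmxA mulmx_diag.
by congr (_ *m diag_mx _); apply/rowP => a; rewrite !mxE big_cons pj.
Qed.

Definition energy (R : realType) (k n : nat) (P : 'M['F_2]_(k, n)) (theta : R)
    (a : 'rV['F_2]_n) : R :=
  theta * \sum_(r < k) F2_sign ((P *m a^T) r 0).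

Lemma hamiltonian_character (R : realType) (k n : nat) (P : 'M['F_2]_(k, n))
    (theta : R) :
  hamiltonian P theta *m character_mx (R[i] : numFieldType) n =
  character_mx (R[i] : numFieldType) n *m
    diag_mx (\row_a (energy P theta (basis_label a))%:C%C).
Proof.
rewrite mulmx_suml.
under eq_bigr => r _.
  have -> : \prod_(j < n | P r j == 1) pauliX_on R[i] j =
      \prod_(j < n | row r P 0 j == 1) pauliX_on R[i] j.
    by apply: eq_bigl => j; rewrite mxE.
  rewrite -scalemxAl (pauliX_prod_character _ (row r P)); over.
apply/matrixP => a b; rewrite mul_mx_diag summxE [RHS]mxE.
rewrite /energy [X in _ * X]mxE rmorphM rmorph_sum /= !mulr_sumr.
apply: eq_bigr => r _.
by rewrite mul_mx_diag !mxE /= dotv_row !mxE rmorph_F2_sign mulrCA.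
Qed.

Lemma complex_sum (R : rcfType) (I : Type) (r : seq I) (P : pred I)
    (f g : I -> R) :
  \sum_(i <- r | P i) (f i +i* g i)%C =
  ((\sum_(i <- r | P i) f i) +i* (\sum_(i <- r | P i) g i))%C.
Proof.
elim: r => [|i r IH]; first by rewrite !big_nil.
by rewrite !big_cons; case: (P i); rewrite IH.
Qed.

(** Diagonalization makes the amplitude the normalized Fourier transform of [cos + i sin] of the
    energy; the squared modulus then splits into two real squares. *)
Lemma outcome_probE (R : realType) (k n : nat) (P : 'M['F_2]_(k, n)) (theta : R)
    (x : 'rV['F_2]_n) :
  outcome_prob P theta x =
  ((\sum_a F2_sign (dotv x a) * cos (energy P theta a)) ^+ 2 +
   (\sum_a F2_sign (dotv x a) * sin (energy P theta a)) ^+ 2) /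
  (qubit_dim n)%:R ^+ 2.
Proof.
set K : numFieldType := R[i].
set N := qubit_dim n; set V := character_mx K n.
pose W := N%:R^-1 *: V.
have VW : V *m W = 1%:M.
  by rewrite -scalemxAr character_mx_sqr scale_scalar_mx mulVf // qubit_dim_neq0.
have WV : W *m V = 1%:M.
  by rewrite -scalemxAl character_mx_sqr scale_scalar_mx mulVf // qubit_dim_neq0.
pose d : 'rV[K]_N := \row_a ('i * (energy P theta (basis_label a))%:C)%C.
pose e : 'rV[K]_N := \row_a (cos (energy P theta (basis_label a)) +i*
                        sin (energy P theta (basis_label a)))%C.
rewrite /outcome_prob (expmx_diagonalizable (K := K) (d := d) (e := e) WV _ VW) //.
- have NC : N%:R^-1 = ((N%:R^-1 : R)%:C)%C :> K.
    by rewrite fmorphV -[in LHS](rmorph_nat (real_complex R)).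
  have -> : bra_ket x (V *m diag_mx e *m W) 0 =
      ((\sum_a F2_sign (dotv x a) * cos (energy P theta a)) / N%:R +i*
       ((\sum_a F2_sign (dotv x a) * sin (energy P theta a)) / N%:R))%C.
    rewrite !mulr_suml -complex_sum /bra_ket mxE.
    rewrite [RHS](reindex (@basis_label n)) /=; last first.
      by apply: onW_bij; exact: enum_val_bij.
    apply: eq_bigr => a _; rewrite mul_mx_diag !mxE /basis_label !enum_rankK.
    (* Every character is 1 at the initial state 0, so [W] contributes only the normalization. *)
    rewrite dotv0 F2_sign0 mulr1 NC.
    rewrite -[F2_sign (_ : 'F_2) in LHS](rmorph_F2_sign (real_complex R)).
    by simpc.
  rewrite /= sqr_sqrtr ?addr_ge0 ?sqr_ge0 //.
  by rewrite !expr_div_n mulrDl.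
(* Inserting [V *m W] on the right of the Hamiltonian gives the diagonal form, and the scalar ['i]
   moves into the diagonal. *)
- rewrite -[LHS]mulmx1 -VW mulmxA -scalemxAl hamiltonian_character scalemxAr.
  congr (_ *m _ *m _); apply/matrixP => a b.
  by rewrite !mxE mulrnAr.
- by move=> a; rewrite !mxE; apply: cvg_expi.
Qed.

(** * The column code and its uniform law *)

(** Columns are the images of unit vectors, and [A *m a] combines them with coefficients [a]. This
    parametrizes the code by all vectors [a]. *)
Lemma column_codeE (l n : nat) (A : 'M['F_2]_(l, n)) :
  column_code A = limg (linfun (mulmx A : 'cV_n -> 'cV_l)).
Proof.
apply/eqP; rewrite eqEsubv; apply/andP; split.
  apply/span_subvP => _ /mapP[j _ ->].
  by apply/memv_imgP; exists (delta_mx j 0); rewrite ?memvf // lfunE /= colE.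
apply/subvP => _ /memv_imgP[a _ ->]; rewrite lfunE /=.
have -> : A *m a = \sum_j a j 0 *: col j A.
  apply/colP => i; rewrite mxE summxE; apply: eq_bigr => j _.
  by rewrite !mxE mulrC.
apply: memv_suml => j _; apply: memvZ; apply: memv_span.
by apply: map_f; rewrite mem_enum.
Qed.

Lemma column_codeP (l n : nat) (A : 'M['F_2]_(l, n)) (c : 'cV_l) :
  reflect (exists a : 'cV_n, c = A *m a) (c \in column_code A).
Proof.
rewrite column_codeE; apply: (iffP memv_imgP) => [[a _ ->]|[a ->]].
  by exists a; rewrite lfunE.
by exists a; rewrite ?memvf // lfunE.
Qed.

(* All the fibres of a -> A a over the code are translates of its kernel. *)
Lemma uniform_expectation_column_code (R : realType) (l n : nat)
    (A : 'M['F_2]_(l, n)) (f : 'cV_l -> R) :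
  uniform_expectation (column_code A) f =
  (\sum_(a : 'rV_n) f (A *m a^T)) / (qubit_dim n)%:R.
Proof.
set C := column_code A; pose z := #|[set a : 'rV['F_2]_n | A *m a^T == 0]%SET|.
have sumE (g : 'cV_l -> R) :
    \sum_(a : 'rV_n) g (A *m a^T) = z%:R * \sum_(c | c \in C) g c.
  rewrite (partition_big (fun a => A *m a^T) (mem C)) /=; last first.
    by move=> a _; apply/column_codeP; exists a^T.
  rewrite mulr_sumr; apply: eq_bigr => _ /column_codeP[b ->].
  under eq_bigr => a /eqP-> do over.
  rewrite sumr_const mulr_natl; congr (_ *+ _).
  rewrite -[RHS](card_imset _ (addrI b^T)); apply: eq_card => a.
  apply/idP/imsetP => [Aa|[a']].
    have {}Aa : A *m a^T = A *m b by apply/eqP.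
    exists (a - b^T); last by rewrite addrC subrK.
    by rewrite inE linearB /= mulmxBr Aa trmxK subrr.
  rewrite inE => /eqP Aa' ->; apply/eqP.
  by rewrite linearD /= mulmxDr Aa' trmxK addr0.
have z0 : z%:R != 0 :> R.
  rewrite pnatr_eq0 -lt0n; apply/card_gt0P; exists 0.
  by rewrite inE trmx0 mulmx0.
(* The fibre count for the constant function 1 compares the cardinalities. *)
have NE : (qubit_dim n)%:R = z%:R * #|C|%:R :> R.
  by have := sumE (fun=> 1); rewrite !sumr_const.
by rewrite /uniform_expectation sumE NE -mulf_div divff // mul1r.
Qed.

(** * From energy differences to the law of the dot product *)

Lemma sum_F2_sign_wt (K : pzRingType) (l : nat) (c : 'cV['F_2]_l) :
  \sum_i F2_sign (c i 0) = l%:R - 2 * (wt c)%:R :> K.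
Proof.
have -> : l%:R = \sum_(i < l) 1 :> K by rewrite sumr_const card_ord.
have -> : (wt c)%:R = \sum_i (c i 0 != 0)%:R :> K.
  rewrite /wt -sum1_card natr_sum [LHS]big_mkcond /=.
  by apply: eq_bigr => i _; rewrite inE; case: (_ != _).
rewrite mulr_sumr -sumrB; apply: eq_bigr => i _; rewrite /F2_sign.
case: (c i 0 != 0); rewrite ?mulr0 ?subr0 // mulr1 expr1.
by rewrite (_ : 2 = 1 + 1) // opprD addNKr.
Qed.

(** Shifting by [s] multiplies the sign of row [r] by that of [dotv (row r P) s]: the other rows
    cancel, the kept ones double. The factor 2 stays outside as [*+ 2] for the double-angle
    formula. *)
Lemma energy_shift (R : realType) (k n : nat) (P : 'M['F_2]_(k, n)) (theta : R)
    (a s : 'rV_n) :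
  energy P theta a - energy P theta (a + s) =
  (theta * ((row_count P s)%:R - 2 * (wt (row_part P s *m a^T))%:R)) *+ 2.
Proof.
rewrite -sum_F2_sign_wt /energy -mulrBr -mulrnAr; congr (_ * _).
rewrite -sumrB -sumrMnl.
have rowE i : (row_part P s *m a^T) i 0 = (P *m a^T) (enum_val i) 0.
  by rewrite !mxE; apply: eq_bigr => j _; rewrite !mxE.
under [RHS]eq_bigr => i _ do rewrite rowE.
rewrite -(big_enum_val (fun r => F2_sign ((P *m a^T) r 0) *+ 2)) /=.
rewrite [RHS]big_mkcond /=; apply: eq_bigr => r _.
rewrite -!dotv_row dotvDr F2_signD inE -F2_eq0 {3}/F2_sign.
case: (_ != _); first by rewrite mulrN1 opprK mulr2n.
by rewrite mulr1 subrr.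
Qed.

(** The cosine and sine correlations add up to the cosine of a difference; one of the two factors
    [qubit_dim n] in the denominator cancels. *)
Lemma sum_F2_sign_outcome_prob (R : realType) (k n : nat) (P : 'M['F_2]_(k, n))
    (theta : R) (s : 'rV_n) :
  \sum_x F2_sign (dotv x s) * outcome_prob P theta x =
  (\sum_a cos (energy P theta a - energy P theta (a + s))) / (qubit_dim n)%:R.
Proof.
have N0 := qubit_dim_neq0 R n.
under eq_bigr => x _ do rewrite outcome_probE mulrA mulrDr.
rewrite -mulr_suml big_split /= !fourier_correlation -mulrDr -big_split /=.
under eq_bigr => a _ do rewrite -cosB.
by field.
Qed.

Lemma sum_outcome_prob (R : realType) (k n : nat) (P : 'M['F_2]_(k, n))
    (theta : R) :
  \sum_x outcome_prob P theta x = 1.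
Proof.
have := sum_F2_sign_outcome_prob P theta 0.
under eq_bigr => x _ do rewrite dotv0 F2_sign0 mul1r.
move=> ->; under eq_bigr => a _ do rewrite addr0 subrr cos0.
by rewrite sumr_const divff // qubit_dim_neq0.
Qed.

Lemma sum_outcome_prob_dotv0 (R : realType) (k n : nat) (P : 'M['F_2]_(k, n))
    (theta : R) (s : 'rV_n) :
  \sum_(x | dotv x s == 0) outcome_prob P theta x =
  uniform_expectation (column_code (row_part P s))
    (fun c => cos (theta * ((row_count P s)%:R - 2 * (wt c)%:R)) ^+ 2).
Proof.
rewrite uniform_expectation_column_code.
(* The indicator of [dotv x s = 0] is half of 1 plus the sign. *)
transitivity ((\sum_x outcome_prob P theta x +
    \sum_x F2_sign (dotv x s) * outcome_prob P theta x) / 2).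
  rewrite -big_split mulr_suml big_mkcond /=; apply: eq_bigr => x _.
  by rewrite /F2_sign; case: eqP => _ /=; field.
rewrite sum_outcome_prob sum_F2_sign_outcome_prob.
(* The -1 of the double-angle formula cancels the total probability 1. *)
under eq_bigr => a _ do rewrite energy_shift cos_mulr2n.
rewrite sumrB sumr_const sumrMnl.
have N0 := qubit_dim_neq0 R n.
rewrite [#|_|]/(qubit_dim n).
by field.
Qed.

(** The law is given on points only, so the event is cut into finitely many disjoint fibres of
    [X]. *)
Lemma outcome_law_dotv0 (R : realType) (k n : nat) (P : 'M['F_2]_(k, n))
    (theta : R) (d : measure_display) (T : measurableType d)
    (Pr : probability T R) (X : T -> 'rV['F_2]_n) (s : 'rV['F_2]_n) :
  has_outcome_law P theta Pr X ->
  Pr [set w | dotv (X w) s = 0] =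
  (uniform_expectation (column_code (row_part P s))
     (fun c => cos (theta * ((row_count P s)%:R - 2 * (wt c)%:R)) ^+ 2))%:E.
Proof.
move=> [mX PX]; rewrite -sum_outcome_prob_dotv0.
have -> : [set w | dotv (X w) s = 0] =
    \bigcup_(x in [set x | dotv x s = 0]) X @^-1` [set x].
  apply/seteqP; split => [w Xw|w [x /= xs ->] //].
  by exists (X w).
rewrite measure_fin_bigcup => [||//|x _]; last exact: mX.
- rewrite (fsbigE (enum [pred x | dotv x s == 0])) ?enum_uniq //.
  + rewrite big_enum_cond /= -sumEFin; apply: eq_big => [x|x _].
      by rewrite !inE; case: eqP => [xs|//]; rewrite mem_set.
    by rewrite PX.
  + by move=> x /=; rewrite mem_enum inE => /eqP.
  + by move=> x /= /eqP xs; rewrite mem_enum inE xs.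
- exact: finite_finset.
- exact: trivIset_preimage1.
Qed.

(** * Reading the expectation off the weight enumerator *)

(** The additive functional with value [g i j] on the monomial with exponents [i] in ['X] and [j] in
    ['Y]. The ranges come from [w] itself, so no code length has to be supplied. *)
Definition coef_functional (R : pzRingType) (g : nat -> nat -> R)
    (w : {poly {poly int}}) : R :=
  \sum_(i < size w) \sum_(j < size w`_i) (w`_i`_j)%:~R * g i j.

Lemma coef_functional_widen (R : pzRingType) (g : nat -> nat -> R)
    (w : {poly {poly int}}) (m : nat) :
  (size w <= m)%N -> (forall i, (size (w`_i)%R <= m)%N) ->
  coef_functional g w = \sum_(i < m) \sum_(j < m) (w`_i`_j)%:~R * g i j.
Proof.
move=> wm wim; pose G i : R := \sum_(j < size w`_i) (w`_i`_j)%:~R * g i j.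
rewrite /coef_functional (big_ord_widen m G) // big_mkcond.
apply: eq_bigr => i _; have [_|wi] := ltnP i (size w); last first.
  by rewrite [RHS]big1 // => j _; rewrite (nth_default 0 wi) coef0 mul0r.
rewrite /G (big_ord_widen m (fun j => (w`_i`_j)%:~R * g i j)) // big_mkcond /=.
apply: eq_bigr => j _; case: ltnP => // wij.
by rewrite (nth_default 0 wij) mul0r.
Qed.

Lemma coef_weight_enumerator (l : nat) (C : {vspace 'cV['F_2]_l}) (i j : nat) :
  (weight_enumerator C)`_i`_j =
  \sum_(c | c \in C) ((i == wt c) && (j == l - wt c)%N)%:R.
Proof.
rewrite !coef_sum; apply: eq_bigr => c _.
rewrite -polyC_exp coefMC coefXn mulr_natl coefMn coefXn.
by case: (i == _); rewrite ?mulr0n // mulr1n.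
Qed.

Lemma coef_functional_weight_enumerator (R : pzRingType) (g : nat -> nat -> R)
    (l : nat) (C : {vspace 'cV['F_2]_l}) :
  coef_functional g (weight_enumerator C) =
  \sum_(c | c \in C) g (wt c) (l - wt c)%N.
Proof.
set w := weight_enumerator C.
(* A common bound for both sizes; [l.+1] makes [wt c] and [l - wt c] valid indices below [m]. *)
pose m := maxn l.+1 (maxn (size w) (\max_(i < size w) size (w`_i)%R)).
have lm i : (i <= l)%N -> (i < m)%N by move=> il; rewrite leq_max ltnS il.
rewrite (@coef_functional_widen _ _ _ m); last 2 first.
- by rewrite !leq_max leqnn orbT.
- move=> i; have [iw|wi] := ltnP i (size w); last first.
    by rewrite (nth_default 0 wi) size_poly0.
  rewrite !leq_max; apply/orP; right; apply/orP; right.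
  exact: (leq_bigmax (Ordinal iw)).
under eq_bigr => i _.
  under eq_bigr => j _.
    rewrite coef_weight_enumerator rmorph_sum mulr_suml; over.
  rewrite exchange_big; over.
rewrite exchange_big /=; apply: eq_bigr => c _.
have cl : (wt c <= l)%N by rewrite -[leqRHS]card_ord max_card.
rewrite (bigD1 (Ordinal (lm _ cl))) //= [X in _ + X]big1 ?addr0; last first.
  move=> i ic; apply: big1 => j _; rewrite -val_eqE /= in ic.
  by rewrite (negbTE ic) mul0r.
rewrite (bigD1 (Ordinal (lm _ (leq_subr (wt c) l)))) //= !eqxx mul1r.
rewrite big1 ?addr0 // => j jc; rewrite -val_eqE /= in jc.
by rewrite (negbTE jc) mul0r.
Qed.

(** The denominator, the functional of the constant 1, counts the codewords. *)
Lemma uniform_expectation_weight (R : realType) (l : nat)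
    (C : {vspace 'cV['F_2]_l}) (g : R -> R) :
  uniform_expectation C (fun c => g (l%:R - 2 * (wt c)%:R)) =
  coef_functional (fun i j => g (j%:R - i%:R)) (weight_enumerator C) /
  coef_functional (fun _ _ => 1) (weight_enumerator C).
Proof.
rewrite !coef_functional_weight_enumerator sumr_const.
congr (_ / _); apply: eq_bigr => c _; congr g.
have cl : (wt c <= l)%N by rewrite -[leqRHS]card_ord max_card.
by rewrite natrB //; ring.
Qed.

(** * Matroid invariance of the weight enumerator *)

(** Permuting coordinates is a weight-preserving bijection between the two codes. *)
Lemma weight_enumerator_row_perm (l n : nat) (u : 'S_l) (A : 'M['F_2]_(l, n)) :
  weight_enumerator (column_code (row_perm u A)) =
  weight_enumerator (column_code A).
Proof.
have wtE (c : 'cV['F_2]_l) : wt (row_perm u c) = wt c.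
  rewrite /wt -[RHS](card_preimset _ (@perm_inj _ u)).
  by apply: eq_card => i; rewrite !inE mxE.
have inj : injective (row_perm u : 'cV['F_2]_l -> _).
  apply: (can_inj (g := row_perm u^-1%g)) => c.
  by rewrite -row_permM mulVg row_perm1.
rewrite /weight_enumerator [LHS](reindex_inj inj) /=.
apply: eq_big => [c|c _]; last by rewrite wtE.
apply/column_codeP/column_codeP => [[a ca]|[a ->]]; exists a.
  by apply: inj; rewrite ca !row_permE mulmxA.
by rewrite !row_permE mulmxA.
Qed.

Lemma column_code_subP (l n n' : nat) (A : 'M['F_2]_(l, n))
    (B : 'M['F_2]_(l, n')) (E : 'M['F_2]_(n', n)) :
  A = B *m E -> (column_code A <= column_code B)%VS.
Proof.
move=> AE; apply/subvP => _ /column_codeP[a ->].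
by apply/column_codeP; exists (E *m a); rewrite AE mulmxA.
Qed.

(** Column operations are right multiplications. Factoring both ways replaces invertibility, which
    would exclude a change in the number of columns. *)
Lemma eq_column_code (l n n' : nat) (A : 'M['F_2]_(l, n))
    (B : 'M['F_2]_(l, n')) (E : 'M['F_2]_(n', n)) (E' : 'M['F_2]_(n, n')) :
  A = B *m E -> B = A *m E' -> column_code A = column_code B.
Proof.
move=> /column_code_subP AB /column_code_subP BA.
by apply/eqP; rewrite eqEsubv AB BA.
Qed.

Lemma same_matroid_weight_enumerator (l n l' n' : nat) (A : 'M['F_2]_(l, n))
    (B : 'M['F_2]_(l', n')) :
  same_matroid A B ->
  weight_enumerator (column_code A) = weight_enumerator (column_code B).
Proof.
elim=> {l n l' n' A B}.
- by [].
- by move=> l n l' n' A B _ ->.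
- by move=> l n l' n' l'' n'' A B C _ -> _ ->.
- by move=> l n u A; rewrite weight_enumerator_row_perm.
- move=> l n j1 j2 A; congr weight_enumerator.
  apply: (@eq_column_code _ _ _ _ _ (tperm_mx j1 j2) (tperm_mx j1 j2)).
    by rewrite xcolE -mulmxA -perm_mxM tperm2 perm_mx1 mulmx1.
  by rewrite xcolE.
- move=> l n j1 j2 A j12; congr weight_enumerator.
  set B := \matrix_(r, j) _.
  have BE : B = A *m (1%:M + delta_mx j1 j2).
    apply/matrixP => r j; rewrite mulmxDr mulmx1 !mxE; congr (_ + _).
    rewrite (bigD1 j1) //= big1 ?addr0 => [|i ij].
      by rewrite mxE eqxx /=; case: (j == j2); rewrite ?mulr1 ?mulr0.
    by rewrite mxE (negbTE ij) mulr0.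
  apply: (@eq_column_code _ _ _ _ _ (1%:M + delta_mx j1 j2) _ _ BE).
  (* In characteristic 2 this transvection is its own inverse. *)
  suff EE : (1%:M + delta_mx j1 j2) *m (1%:M + delta_mx j1 j2) =
      1%:M :> 'M['F_2]_n.
    by rewrite BE -mulmxA EE mulmx1.
  rewrite mulmxDl mul1mx mulmxDr mulmx1 mul_delta_mx_0 1?eq_sym // addr0 -addrA.
  have /eqP-> : delta_mx j1 j2 + delta_mx j1 j2 == 0 :> 'M['F_2]_n.
    by rewrite F2_addr_eq0.
  by rewrite addr0.
- move=> l n A; congr weight_enumerator.
  (* The first witness deletes the last column, the second appends an empty one. *)
  apply: (@eq_column_code _ _ _ _ _ (col_mx 1%:M 0) (row_mx 1%:M 0)).
    by rewrite mul_row_col mulmx1 mul0mx addr0.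
  by rewrite mul_mx_row mulmx1 mulmx0.
Qed.

Theorem mainTheorem13 (R : realType) :
  (forall (k n : nat) (P : 'M['F_2]_(k, n)) (theta : R),
     \sum_(x : 'rV['F_2]_n) outcome_prob P theta x = 1) /\
  (forall (k n : nat) (P : 'M['F_2]_(k, n)) (theta : R)
     (d : measure_display) (T : measurableType d) (Pr : probability T R)
     (X : T -> 'rV['F_2]_n) (hX : has_outcome_law P theta Pr X)
     (s : 'rV['F_2]_n),
     Pr [set w | dotv (X w) s = 0] =
     (uniform_expectation (column_code (row_part P s))
        (fun c => cos (theta * ((row_count P s)%:R - 2 * (wt c)%:R)) ^+ 2))%:E) /\
  (exists F : R -> {poly {poly int}} -> R,
     forall (k n : nat) (P : 'M['F_2]_(k, n)) (theta : R)
       (d : measure_display) (T : measurableType d) (Pr : probability T R)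
       (X : T -> 'rV['F_2]_n) (hX : has_outcome_law P theta Pr X)
       (s : 'rV['F_2]_n),
       Pr [set w | dotv (X w) s = 0] =
       (F theta (weight_enumerator (column_code (row_part P s))))%:E) /\
  (forall (k n : nat) (P : 'M['F_2]_(k, n)) (s : 'rV['F_2]_n)
     (k' n' : nat) (P' : 'M['F_2]_(k', n')) (s' : 'rV['F_2]_n'),
     same_matroid (row_part P s) (row_part P' s') ->
     weight_enumerator (column_code (row_part P s)) =
     weight_enumerator (column_code (row_part P' s'))).
Proof.
split; first exact: sum_outcome_prob.
split; first by move=> *; exact: outcome_law_dotv0.
split; last by move=> *; exact: same_matroid_weight_enumerator.
exists (fun theta w =>
  coef_functional (fun i j => cos (theta * (j%:R - i%:R)) ^+ 2) w /
  coef_functional (fun _ _ => 1) w) => k n P theta d T Pr X hX s.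
rewrite (outcome_law_dotv0 s hX); congr (_%:E).
exact: (uniform_expectation_weight _ (fun t => cos (theta * t) ^+ 2)).
Qed.
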